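(* Let $\mathcal{L}\subseteq\mathrm{Fin}$ be nonempty, downward $\preceq$-closed and ccs. Then there are $2^{\aleph_0}$-many pairwise $\trianglelefteq^{\mathcal{L}}_{\mathrm{LO}}$-incomparable $\trianglelefteq^{\mathcal{L}}_{\mathrm{LO}}$-minimal elements in $\mathrm{LO}$. Thus every basis $\mathcal{B}$ for $\trianglelefteq^{\mathcal{L}}_{\mathrm{LO}}$ has cardinality $2^{\aleph_0}$. Moreover, every such basis $\mathcal{B}$ is ill-founded with respect to $\trianglelefteq^{\mathcal{L}}_{\mathrm{LO}}$, and thus it cannot be an antichain.
   Context: Linear orders are reflexive and nonempty. $L\preceq L'$ means there is an embedding $f:L\to L'$, i.e. $x\le_L y\iff f(x)\le_{L'}f(y)$. $\mathrm{LO}\subseteq 2^{\mathbb{N}\times\mathbb{N}}$ is the set of (codes for) linear orders with domain $\mathbb{N}$; $\mathrm{Fin}$ is the set of (codes for) nonempty linear orders on finite subsets of $\mathbb{N}$; $\mathrm{Lin}=\mathrm{Fin}\cup\mathrm{LO}$. A class $\mathcal{L}\subseteq\mathrm{Lin}$ is downward $\preceq$-closed if $K\in\mathrm{Lin}$ and $K\preceq L\in\mathcal{L}$ imply $K\in\mathcal{L}$; membership in $\mathcal{L}$ is meant up to isomorphism. A subset $I$ of a linear order $L$ is convex if $x\le_L y\le_L z$ and $x,z\in I$ imply $y\in I$. For $A,B\subseteq L$ write $A\le_L B$ (resp. $A<_L B$) if $a\le_L b$ (resp. $a<_L b$) for all $a\in A$, $b\in B$. A $K$-convex partition of $L$ is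 a partition $(L_k)_{k\in K}$ of $L$ (into nonempty sets) such that $k<_K k'\iff L_k<_L L_{k'}$. The relation $L\trianglelefteq^{\mathcal{L}}L'$ holds iff there are $K\in\mathcal{L}$, a $K$-convex partition $(L_k)_{k\in K}$ of $L$, and an embedding $f$ of $L$ into $L'$ such that $f(L_k)$ is a convex subset of $L'$ for every $k\in K$. $\trianglelefteq^{\mathcal{L}}_{\mathrm{LO}}$ is its restriction to $\mathrm{LO}$. $\mathcal{L}$ is ccs (closed under convex sums) if for all $K,K'\in\mathcal{L}$ and every family $(K'_k)_{k\in K}$ of nonempty convex subsets of $K'$ such that $k_0<_K k_1\Rightarrow K'_{k_0}\le_{K'}K'_{k_1}$, we have $\sum_{k\in K}K'_k\in\mathcal{L}$, where $\sum_{k\in K}K'_k=\{(x,k): k\in K, x\in K'_k\}$ ordered antilexicographically. When $\mathcal{L}$ is ccs, $\trianglelefteq^{\mathcal{L}}$ is a quasi-order. For a quasi-order $\precsim$ on $X$: $x$ is minimal if there is no $y\in X$ with $y\precsim x$ and $x\not\precsim y$; $\mathcal{B}\subseteq X$ is a basis if for every $x\in X$ there is $b\in\mathcal{B}$ with $b\precsim x$; $\mathcal{B}$ is ill-founded if it contains an infinite strictly $\precsim$-decreasing sequence; an antichain is a set of pairwise $\precsim$-incomparable elements. *)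

(* Defs.v *)
From mathcomp Require Import all_boot.
From mathcomp Require Import boolp classical_sets functions cardinality.

Set Implicit Arguments.
Unset Strict Implicit.
Unset Printing Implicit Defensive.

Local Open Scope classical_set_scope.

(* A linear order on a subset of T is coded by its (reflexive) graph r : rel T,
   as an element of 2^(T x T); its domain is recovered as the set of points
   related to themselves. *)
Definition dom (T : Type) (r : rel T) : set T := [set x | r x x].

Definition strict (T : eqType) (r : rel T) (x y : T) : bool :=
  r x y && (x != y).

Definition linear_order (T : Type) (r : rel T) : Prop :=
  [/\ forall x y, r x y -> dom r x /\ dom r y,
      antisymmetric r,
      transitive r &
      forall x y, dom r x -> dom r y -> r x y || r y x].

Definition LO : set (rel nat) :=
  [set r | linear_order r /\ dom r = [set: nat]].

Definition Fin : set (rel nat) :=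
  [set r | [/\ linear_order r, dom r !=set0 & finite_set (dom r)]].

Definition Lin : set (rel nat) := Fin `|` LO.

(* Only the values of f on dom r matter. *)
Definition embedding (T U : Type) (r : rel T) (s : rel U) (f : T -> U) : Prop :=
  set_fun (dom r) (dom s) f /\
  (forall x y, dom r x -> dom r y -> r x y <-> s (f x) (f y)).

Definition embeds (T U : Type) (r : rel T) (s : rel U) : Prop :=
  exists f, embedding r s f.

Definition isomorphic (T U : Type) (r : rel T) (s : rel U) : Prop :=
  exists2 f, embedding r s f & set_bij (dom r) (dom s) f.

(* Membership of a linear order (on any type) in a class of codes,
   up to isomorphism. *)
Definition in_class (T : Type) (L : set (rel nat)) (r : rel T) : Prop :=
  exists2 M, L M & isomorphic M r.

Definition downward_closed (L : set (rel nat)) : Prop :=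
  forall K M, Lin K -> L M -> embeds K M -> L K.

Definition convex_subset (T : Type) (r : rel T) (I : set T) : Prop :=
  I `<=` dom r /\ (forall x y z, r x y -> r y z -> I x -> I z -> I y).

Definition set_le (T : Type) (r : rel T) (A B : set T) : Prop :=
  forall a b, A a -> B b -> r a b.

Definition set_lt (T : eqType) (r : rel T) (A B : set T) : Prop :=
  forall a b, A a -> B b -> strict r a b.

Definition convex_partition (T U : eqType) (K : rel U) (L : rel T)
    (P : U -> set T) : Prop :=
  partition (dom K) P (dom L) /\
  (forall k k', dom K k -> dom K k' ->
     strict K k k' <-> set_lt L (P k) (P k')).

Definition pconvex (C : set (rel nat)) (L L' : rel nat) : Prop :=
  exists K : rel nat, exists P : nat -> set nat, exists f : nat -> nat,
    [/\ C K, convex_partition K L P, embedding L L' f &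
        forall k, dom K k -> convex_subset L' (f @` P k)].

(* The sum over k in K of the suborders P k of K', as the antilexicographic
   order on the pairs (x, k) with k in dom K and x in P k. *)
Definition convex_sum (K K' : rel nat) (P : nat -> set nat) : rel (nat * nat) :=
  fun p q => `[< [/\ dom K p.2 /\ P p.2 p.1, dom K q.2 /\ P q.2 q.1 &
                     strict K p.2 q.2 \/ (p.2 = q.2 /\ K' p.1 q.1)] >].

Definition ccs (L : set (rel nat)) : Prop :=
  forall (K K' : rel nat) (P : nat -> set nat),
    L K -> L K' ->
    (forall k, dom K k -> P k !=set0 /\ convex_subset K' (P k)) ->
    (forall k0 k1, dom K k0 -> dom K k1 -> strict K k0 k1 ->
       set_le K' (P k0) (P k1)) ->
    in_class L (convex_sum K K' P).

Definition qo_minimal (T : Type) (X : set T) (R : T -> T -> Prop)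
    (x : T) : Prop :=
  X x /\ ~ (exists y, [/\ X y, R y x & ~ R x y]).

Definition qo_basis (T : Type) (X : set T) (R : T -> T -> Prop)
    (B : set T) : Prop :=
  B `<=` X /\ (forall x, X x -> exists2 b, B b & R b x).

Definition qo_ill_founded (T : Type) (R : T -> T -> Prop)
    (B : set T) : Prop :=
  exists u : nat -> T,
    (forall n, B (u n)) /\
    (forall n, R (u n.+1) (u n) /\ ~ R (u n) (u n.+1)).

Definition qo_antichain (T : Type) (X : set T) (R : T -> T -> Prop)
    (A : set T) : Prop :=
  A `<=` X /\ (forall x y, A x -> A y -> x <> y -> ~ R x y /\ ~ R y x).

Definition continuum (T : Type) (A : set T) : Prop :=
  (A #= [set: nat -> bool])%card.

(* Main.v *)
Require Import Defs.
From mathcomp Require Import all_boot all_order.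
From mathcomp Require Import boolp classical_sets functions cardinality.
From mathcomp Require Import zify.

Set Implicit Arguments.
Unset Strict Implicit.
Unset Printing Implicit Defensive.

Import Order.TTheory.

Local Open Scope classical_set_scope.

(** Call an order convexly embeddable in another if it is isomorphic to a convex
part of it. If [Y] is infinite and [Y] lies below [Z], one of the finitely many
pieces of [Y] is infinite, and it is isomorphic to a convex part of [Z]; in the
other direction, convex embeddability implies [pconvex L] because [L] contains
the one-point orders. So it suffices to find orders that reappear in all of their
infinite convex parts.

Given [c], the order [block_order c] lives on the tree of finite sequences of
natural numbers: a node of depth [l] carries its subtrees and finite blocks,
arranged as subtree 0, block 0, subtree 1, block 1, and so on, the [i]-th block
having [c l i + 1] elements. Two points of different blocks have a full subtree
between them ([word_lt]), so every infinite convex part contains a full subtree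
([infinite_convex_graft]), and the blocks are the maximal runs of consecutive
elements, which convex embeddings preserve.

If [c] does not depend on the depth, then every subtree is a copy of the whole
order. Hence everything below [block_order c] convexly embeds it
([pconvex_block_code_subtree]) and the order is minimal. A function
[f : nat -> bool] is coded by block sizes [2 k + f k + 1], each repeated
infinitely often at every node. A size that occurs infinitely often at the root
occurs infinitely often in one of the pieces of a finite convex partition, so it
is a block size of every block order above ([pconvex_block_size]). Therefore distinct [f]
give orders with no common lower bound; this yields continuum many pairwise
incomparable minimal orders, and forces a basis to have continuum many elements.

If instead all blocks at depth [l] have [n + l + 1] elements, then each order
below this one contains a subtree, say with root blocks of size [m + 1], and the
subtrees one level deeper have no block of that size. A basis element below such
a deeper subtree is strictly below the given order ([growing_step]); iterating
gives a strictly decreasing sequence in the basis, which is then not an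
antichain. *)

(** * Isomorphisms between convex parts *)

(** [h] restricts to an isomorphism from the convex part [I] of [r] onto a
    convex part of [s]. *)
Definition convex_emb (T U : Type) (r : rel T) (s : rel U) (I : set T)
    (h : T -> U) : Prop :=
  [/\ convex_subset r I,
      forall x y, I x -> I y -> r x y = s (h x) (h y) &
      convex_subset s (h @` I)].

(** [r] is isomorphic to a convex part of [s]. *)
Definition convex_embeds (T U : Type) (r : rel T) (s : rel U) : Prop :=
  exists h, convex_emb r s (dom r) h.

(** [y] is the immediate successor of [x]. *)
Definition covers (T : Type) (r : rel T) (x y : T) : Prop :=
  [/\ r x y, x <> y & forall z, r x z -> r z y -> z = x \/ z = y].

Section ConvexEmbeddings.
Variables (T U V : Type).
Implicit Types (r : rel T) (s : rel U) (t : rel V).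

Lemma convex_dom r : linear_order r -> convex_subset r (dom r).
Proof. by move=> [rd _ _ _]; split=> // x y z /rd[_]. Qed.

Lemma convex_emb_dom r s I h x : convex_emb r s I h -> I x -> dom s (h x).
Proof. by move=> [_ _ [sub _]] Ix; apply: sub; exists x. Qed.

Lemma convex_emb_inj r s I h x y : linear_order r -> convex_emb r s I h ->
  I x -> I y -> h x = h y -> x = y.
Proof.
move=> [_ asym _ _] hE Ix Iy hxy; have [_ hr _] := hE.
have sx : s (h x) (h x) := convex_emb_dom hE Ix.
by apply: asym; rewrite !hr // -hxy sx.
Qed.

Lemma convex_emb_comp r s t I J h g :
  convex_emb r s I h -> convex_emb s t J g ->
  convex_emb r t (I `&` h @^-1` J) (g \o h).
Proof.
move=> [[Id Ic] hr [_ hc]] [[Jd Jc] gs [gd gc]]; split.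
- split=> [x [/Id]//|x y z xy yz [Ix Jx] [Iz Jz]].
  have Iy := Ic _ _ _ xy yz Ix Iz; split=> //=.
  by apply: Jc Jx Jz; rewrite -hr.
- by move=> x y [Ix Jx] [Iy Jy] /=; rewrite hr // gs.
- split=> [_ [x [_ Jx] <-]|x' w z' xw wz [x [Ix Jx] xE] [z [Iz Jz] zE]].
    by apply: gd; exists (h x).
  subst x' z'; have [v Jv vw] : (g @` J) w.
    by apply: gc xw wz _ _; [exists (h x)|exists (h z)].
  rewrite -vw /= -!gs // in xw wz.
  have [y Iy yv] : (h @` I) v by apply: hc xw wz _ _; [exists x|exists z].
  by exists y; [split=> //=; rewrite yv|rewrite /= yv].
Qed.

Lemma convex_emb_inv r s I h (x0 : T) : linear_order r ->
  convex_emb r s I h ->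
  exists g, convex_emb s r (h @` I) g /\ (forall x, I x -> g (h x) = x).
Proof.
move=> rlin hE; have [Ic hr hc] := hE.
have /choice[g gP] : forall u, exists x, (h @` I) u -> I x /\ h x = u.
  move=> u; have [[x Ix <-]|nu] := pselect ((h @` I) u); first by exists x.
  by exists x0.
have gK x : I x -> g (h x) = x.
  move=> Ix; have [Ig hg] : I (g (h x)) /\ h (g (h x)) = h x.
    by apply: gP; exists x.
  exact: (convex_emb_inj rlin hE Ig Ix hg).
exists g; split=> //; split=> //.
  by move=> _ _ [x Ix <-] [y Iy <-]; rewrite !gK ?hr.
rewrite (_ : g @` (h @` I) = I) //; apply/seteqP; split.
  by move=> _ [_ [x Ix <-] <-]; rewrite gK.
by move=> x Ix; exists (h x); [exists x|exact: gK].
Qed.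

Lemma covers_convex_emb r s I h x y : linear_order r -> convex_emb r s I h ->
  I x -> I y -> covers r x y <-> covers s (h x) (h y).
Proof.
move=> rlin hE Ix Iy; have [[_ Ic] hr [_ hc]] := hE.
have inj := convex_emb_inj rlin hE.
split=> -[xy nxy nb].
  split; [by rewrite -hr|by move/(inj _ _ Ix Iy)|move=> w xw wy].
  have [z Iz zw] : (h @` I) w by apply: hc xw wy _ _; [exists x|exists y].
  rewrite -zw -!hr // in xw wy *.
  by case: (nb z xw wy) => ->; [left|right].
split; [by rewrite hr|by move=> xEy; apply: nxy; rewrite xEy|move=> z xz zy].
have Iz := Ic _ _ _ xz zy Ix Iy.
rewrite !hr // in xz zy.
by case: (nb _ xz zy) => /inj; [left|right]; auto.
Qed.

End ConvexEmbeddings.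

Lemma convex_embeds_comp (T U V : Type) (r : rel T) (s : rel U) (t : rel V) :
  convex_embeds r s -> convex_embeds s t -> convex_embeds r t.
Proof.
move=> [h hE] [g gE]; exists (g \o h).
rewrite -[dom r](_ : dom r `&` h @^-1` dom s = dom r); last first.
  by apply/seteqP; split=> [x []|x rx] //; split=> //; exact: convex_emb_dom hE rx.
exact: convex_emb_comp gE.
Qed.

(** * Piecewise convex embeddings *)

(** The pieces of a convex partition are convex, and only their finite number
    matters below. *)
Lemma pconvex_pieces (C : set (rel nat)) (Y Z : rel nat) : C `<=` Fin ->
  linear_order Y -> pconvex C Y Z ->
  exists (D : set nat) (P : nat -> set nat) (f : nat -> nat),
    [/\ finite_set D, \bigcup_(k in D) P k = dom Y &
        forall k, D k -> convex_emb Y Z (P k) f].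
Proof.
move=> CFin [Yd Yasym _ _] [K [P [f [CK [[PU Pdisj _] Plt] [fd fY] fP]]]].
have [[_ _ _ Ktot] _ Kfin] := CFin K CK.
exists (dom K), P, f; split=> // k Kk.
have PY j x : dom K j -> P j x -> dom Y x.
  by move=> Kj Px; rewrite -PU; exists j.
split; last exact: fP.
  split=> [x /(PY _ _ Kk)//|x y z xy yz Px Pz].
  have : dom Y y by have [] := Yd _ _ xy.
  rewrite -{1}PU => -[j Kj Pjy].
  have [kj|/eqP nkj] := eqVneq k j; first by rewrite kj.
  case/orP: (Ktot k j Kk Kj) => [kj|jk].
    have /(Plt _ _ Kk Kj)/(_ z y Pz Pjy)/andP[zy /eqP[]] : strict K k j.
      by rewrite /strict kj; apply/eqP.
    by apply: Yasym; rewrite zy yz.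
  have /(Plt _ _ Kj Kk)/(_ y x Pjy Px)/andP[yx /eqP[]] : strict K j k.
    by rewrite /strict jk; apply/eqP => /esym.
  by apply: Yasym; rewrite yx xy.
move=> x y /(PY _ _ Kk) Yx /(PY _ _ Kk) Yy.
by apply/idP/idP => /(fY _ _ Yx Yy).
Qed.

(** Composing on the right with a one-piece embedding requires no closure
    property of the class. *)
Lemma pconvex_comp_convex (C : set (rel nat)) (X Y Z : rel nat) :
  pconvex C X Y -> convex_embeds Y Z -> pconvex C X Z.
Proof.
move=> [K [P [f [CK KP [fd fX] fP]]]] [h [_ hY [hd hc]]].
exists K, P, (h \o f); split=> //.
  split=> [x Xx|x y Xx Xy /=]; first by apply: hd; exists (f x) => //; exact: fd.
  by rewrite -hY; [exact: fX|exact: fd|exact: fd].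
move=> k Kk; have [PY Pc] := fP k Kk.
split=> [_ [x Px <-]|x' w z' xw wz [x Px xE] [z Pz zE]].
  by apply: hd; exists (f x) => //; apply: PY; exists x.
subst x' z'; have Yx : dom Y (f x) by apply: PY; exists x.
have Yz : dom Y (f z) by apply: PY; exists z.
have [v Yv vw] : (h @` dom Y) w by apply: hc xw wz _ _; [exists (f x)|exists (f z)].
rewrite -vw /= -!hY // in xw wz.
have [y Py yv] : (f @` P k) v by apply: Pc xw wz _ _; [exists x|exists z].
by exists y => //=; rewrite yv.
Qed.

(** A convex embedding is a piecewise one with a single piece, indexed by the
    one-point order on [0]. *)
Lemma convex_pconvex (L : set (rel nat)) (X Y : rel nat) : L !=set0 ->
  L `<=` Fin -> downward_closed L -> dom X !=set0 ->
  convex_embeds X Y -> pconvex L X Y.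
Proof.
move=> [M LM] LFin Ldown [x0 Xx0] [h [[_ Xc] hX hc]].
pose K : rel nat := fun x y => (x == 0) && (y == 0).
have domK : dom K = [set 0].
  by apply/seteqP; split=> x; rewrite /dom /K /= andbb => /eqP.
have LK : L K.
  have [[Md _ _ _] [m Mm] _] := LFin M LM.
  apply: (Ldown K M _ LM).
    left; split; rewrite ?domK; [|by exists 0|exact: finite_set1].
    split=> [x y /andP[/eqP-> /eqP->]|x y|y x z|x y]; rewrite ?domK //.
    - by case/andP=> /andP[/eqP-> /eqP->].
    - by rewrite /K => /andP[-> _] /andP[_ ->].
    - by move=> -> ->.
  exists (fun=> m); split=> [x //|x y]; rewrite domK => -> ->.
  by split.
exists K, (fun=> dom X), h; split=> //.
- split; first split.
  + by rewrite domK /cover bigcup_set1.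
  + by rewrite domK => i j -> ->.
  + by move=> i _; exists x0.
  move=> k k'; rewrite domK => -> ->; split=> // /(_ x0 x0 Xx0 Xx0).
  by rewrite /strict eqxx andbF.
- split=> [x Xx|x y Xx Xy]; first by case: hc => + _; apply; exists x.
  by rewrite hX.
Qed.

(** * The orders built from blocks *)

(** The point [(p, i, j)] is the [j]-th element of the [i]-th block at the node
    [p] of the tree of finite sequences. *)
Definition point : Type := (seq nat * nat * nat)%type.

(** The letters [2 a] lead to the [a]-th subtree and the letters [2 i + 1] to the
    [i]-th block, so that under the lexicographic order the [a]-th subtree of a
    node precedes its [a]-th block, which precedes its [a + 1]-st subtree. *)
Definition word (x : point) : seqlexi nat :=
  map double x.1.1 ++ [:: x.1.2.*2.+1; x.2].

(** The order in which the [i]-th block at a node of depth [l] has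
    [c l i + 1] elements. *)
Definition block_order (c : nat -> nat -> nat) : rel point := fun x y =>
  [&& x.2 <= c (size x.1.1) x.1.2, y.2 <= c (size y.1.1) y.1.2 &
      (word x <= word y)%O].

(** The place of the point [x] of the tree in the copy of the tree rooted at
    [q]. *)
Definition graft (q : seq nat) (x : point) : point := (q ++ x.1.1, x.1.2, x.2).

(** The block sizes in the subtrees at nodes of depth [l]. *)
Definition shift (l : nat) (c : nat -> nat -> nat) : nat -> nat -> nat :=
  fun k => c (l + k).

Lemma lexi_consE (x y : nat) (s t : seqlexi nat) :
  ((x :: s : seqlexi nat) <= y :: t)%O = (x < y) || (x == y) && (s <= t)%O.
Proof. by rewrite lexi_cons !leEnat; case: ltngtP. Qed.

Lemma ltxi_consE (x y : nat) (s t : seqlexi nat) :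
  ((x :: s : seqlexi nat) < y :: t)%O = (x < y) || (x == y) && (s < t)%O.
Proof. by rewrite ltxi_cons !leEnat; case: ltngtP. Qed.

Lemma word_nil i j : word ([::], i, j) = [:: i.*2.+1; j].
Proof. by []. Qed.

Lemma word_cons a p i j : word (a :: p, i, j) = a.*2 :: word (p, i, j).
Proof. by []. Qed.

Lemma word_graft q x : word (graft q x) = map double q ++ word x.
Proof. by rewrite /word /= map_cat -catA. Qed.

Lemma word_graft_le q x y :
  (word (graft q x) <= word (graft q y))%O = (word x <= word y)%O.
Proof.
rewrite !word_graft; elim: q => [//|a q IH].
by rewrite /= lexi_consE ltnn eqxx IH.
Qed.

Lemma graft_cat p q x : graft (p ++ q) x = graft p (graft q x).
Proof. by rewrite /graft -catA. Qed.

Lemma word_inj : injective word.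
Proof.
move=> [[p i] j] [[p' i'] j']; elim: p p' => [|a p IH] [|a' p'].
- by rewrite !word_nil => -[/double_inj-> ->].
- by rewrite word_nil word_cons => -[] /(congr1 odd); rewrite /= !odd_double.
- by rewrite word_nil word_cons => -[] /(congr1 odd); rewrite /= !odd_double.
- by rewrite !word_cons => -[/double_inj-> /IH[-> -> ->]].
Qed.

Lemma ltxi_words (a b : nat) (s t : seqlexi nat) :
  a < b -> ((a :: s : seqlexi nat) < b :: t)%O.
Proof. by rewrite ltxi_consE => ->. Qed.

(** Between two points of different blocks there is a full subtree. *)
Lemma word_lt x y : (word x < word y)%O ->
  [/\ x.1 = y.1 & x.2 < y.2] \/
  exists q, forall z, (word x < word (graft q z) < word y)%O.
Proof.
move: x y => [[p i] j] [[p' i'] j'] /=.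
elim: p p' => [|a p IH] [|a' p'].
- rewrite !word_nil ltxi_consE => /orP[ii'|].
    (* Subtree [i + 1] lies between block [i] and every later block. *)
    right; exists [:: i.+1] => z; rewrite word_graft /=.
    by apply/andP; split; [apply: ltxi_words; lia|];
       case: z => [[[|? ?] ?] ?]; apply: ltxi_words; lia.
  case/andP=> /eqP/succn_inj/double_inj ->.
  by rewrite ltxi_consE andbF orbF; left.
- rewrite word_nil word_cons ltxi_consE => /orP[ia|/andP[/eqP]]; last by lia.
  (* The leftmost subtree at the node of [y]. *)
  right; exists (a' :: p' ++ [:: 0]) => z; rewrite word_graft /= map_cat /= -catA.
  rewrite ltxi_words //= ltxi_consE eqxx ltnn /=.
  elim: (p') => [|b q IHq] /=; first by apply: ltxi_words.
  by rewrite word_cons ltxi_consE eqxx ltnn.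
- rewrite word_nil word_cons ltxi_consE => /orP[ia|/andP[/eqP]]; last by lia.
  (* The subtree right after the block of [x]. *)
  right; exists (a :: p ++ [:: i.+1]) => z; rewrite word_graft /= map_cat /= -catA.
  rewrite andbC ltxi_words //= ltxi_consE eqxx ltnn /=.
  elim: (p) => [|b q IHq] /=; first by apply: ltxi_words => /=; lia.
  by rewrite word_cons ltxi_consE eqxx ltnn.
- rewrite !word_cons ltxi_consE => /orP[aa'|].
    right; exists (a :: p ++ [:: i.+1]) => z.
    rewrite word_graft /= map_cat /= -catA.
    rewrite andbC ltxi_words //= ltxi_consE eqxx ltnn /=.
    elim: (p) => [|b q IHq] /=; first by apply: ltxi_words => /=; lia.
    by rewrite word_cons ltxi_consE eqxx ltnn.
  case/andP=> /eqP/double_inj <- /IH[[[-> ->] jj']|[q qP]]; [by left|right].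
  exists (a :: q) => z.
  by rewrite (graft_cat [:: a]) word_graft /= !ltxi_consE !ltnn !eqxx /=.
Qed.

Lemma word_convex_graft q x y z :
  (word (graft q x) <= word y <= word (graft q z))%O -> exists v, y = graft q v.
Proof.
move: y => [[p i] j]; rewrite !word_graft.
elim: q p => [|a q IH] p /=; first by exists (p, i, j).
case: p => [|b p]; first by rewrite word_nil !lexi_consE /=; lia.
rewrite word_cons !lexi_consE => bE.
have ab : a = b by move: bE; lia.
move: bE; rewrite ab !ltnn !eqxx /= => /IH[v vE].
by exists v; rewrite (graft_cat [:: b]) -vE.
Qed.

Lemma word_convex_block p i j j' y :
  (word (p, i, j) <= word y <= word (p, i, j'))%O ->
  y.1 = (p, i) /\ j <= y.2 <= j'.
Proof.
have blockE k : (p, i, k) = graft p ([::], i, k) by rewrite /graft /= cats0.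
rewrite (blockE j) (blockE j').
move=> yE; have [[[p' i'] j''] vE] := word_convex_graft yE.
move: yE; rewrite vE !word_graft_le /graft /= word_nil.
case: p' vE => [|b p'] _; last by rewrite !word_nil word_cons !lexi_consE; lia.
rewrite !word_nil !lexi_consE !lexi0s !andbT !cats0 => yE.
have ii' : i' = i by move: yE; lia.
by rewrite ii'; split=> //; move: yE; lia.
Qed.

Section BlockOrder.
Variable c : nat -> nat -> nat.
Let r := block_order c.

Lemma dom_block_order : dom r = [set x | x.2 <= c (size x.1.1) x.1.2].
Proof.
by apply/seteqP; split=> x; rewrite /dom /r /block_order /= lexx andbT andbb.
Qed.

Lemma block_orderE x y : dom r x -> dom r y -> r x y = (word x <= word y)%O.
Proof. by rewrite dom_block_order /r /block_order => /= -> ->. Qed.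

Lemma block_order_dom x y : r x y -> dom r x /\ dom r y.
Proof. by rewrite dom_block_order => /and3P[]. Qed.

Lemma block_order_word x y : r x y -> (word x <= word y)%O.
Proof. by case/and3P. Qed.

Lemma block_order_linear : linear_order r.
Proof.
split; first exact: block_order_dom.
- move=> x y /andP[/block_order_word xy /block_order_word yx].
  by apply: word_inj; apply: le_anti; rewrite xy.
- move=> y x z /and3P[vx _ xy] /and3P[_ vz yz].
  by rewrite /r /block_order vx vz (le_trans xy yz).
- by move=> x y rx ry; rewrite !block_orderE // le_total.
Qed.

(** Only consecutive elements of the same block are neighbours. *)
Lemma covers_block_order x y : covers r x y ->
  exists p i j, x = (p, i, j) /\ y = (p, i, j.+1).
Proof.
move=> [xy nxy nb]; have [rx ry] := block_order_dom xy.
have wxy : (word x < word y)%O.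
  rewrite lt_neqAle (block_order_word xy) andbT.
  by apply/eqP => /word_inj.
have between z : dom r z -> ~~ (word x < word z < word y)%O.
  move=> rz; apply/negP => /andP[xz zy].
  case: (nb z); rewrite ?block_orderE // ?ltW // => zE.
  - by rewrite zE ltxx in xz.
  - by rewrite zE ltxx in zy.
case: (word_lt wxy) => [[xy1 xy2]|[q qP]].
  move: x y xy nxy rx ry wxy nb between xy1 xy2 => [u j] [[p i] j'] /=.
  move=> _ _ rx ry _ _ between uE jj'; subst u.
  exists p, i, j; split=> //; congr (_, _).
  apply/eqP; rewrite eqn_leq jj' andbT leqNgt; apply/negP => j1.
  have /negP[] : ~~ (word (p, i, j) < word (p, i, j.+1) < word (p, i, j'))%O.
    apply: between; move: ry; rewrite dom_block_order /=; lia.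
  have lt_block k k' : k < k' -> (word (p, i, k) < word (p, i, k'))%O.
    move=> kk'; elim: (p) => [|a s IH].
      by rewrite !word_nil ltxi_consE eqxx ltnn ltxi_words.
    by rewrite !word_cons ltxi_consE eqxx ltnn.
  by rewrite !lt_block.
have /between/negP[] : dom r (graft q ([::], 0, 0)) by rewrite dom_block_order.
exact: qP.
Qed.

Lemma block_order_covers p i j : dom r (p, i, j.+1) ->
  covers r (p, i, j) (p, i, j.+1).
Proof.
move=> ry; have rx : dom r (p, i, j).
  by move: ry; rewrite dom_block_order /=; lia.
split=> [||z xz zy]; last 2 first.
- by case; lia.
- have /word_convex_block[] : (word (p, i, j) <= word z <= word (p, i, j.+1))%O.
    by rewrite !block_order_word.
  case: z {xz zy} => [u k] /= -> jk.
  have [->|->] : k = j \/ k = j.+1 by lia.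
    by left.
  by right.
rewrite block_orderE //; elim: (p) => [|a s IH].
  by rewrite !word_nil lexi_consE eqxx ltnn lexi_consE /= ltnSn.
by rewrite !word_cons lexi_consE eqxx ltnn.
Qed.

Lemma graft_convex_emb q :
  convex_emb (block_order (shift (size q) c)) r
    (dom (block_order (shift (size q) c))) (graft q).
Proof.
have rg x : dom r (graft q x) <-> x.2 <= shift (size q) c (size x.1.1) x.1.2.
  by rewrite dom_block_order /= size_cat.
split.
- split=> // x y z xy _ _ _; move: xy; rewrite /dom /block_order /=.
  by case/and3P => _ -> _; rewrite lexx.
- by move=> x y _ _; rewrite /r /block_order word_graft_le /= !size_cat.
- split=> [_ [x xv <-]|x' y z' xy yz [x xv xE] [z zv zE]].
    by move: xv; rewrite /dom /block_order /= => /andP[/rg].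
  subst x' z'; have [v yE] : exists v, y = graft q v.
    by apply: (@word_convex_graft q x y z); rewrite !block_order_word.
  have [_] := block_order_dom xy; rewrite yE => /rg vv.
  by exists v => //; rewrite /dom /block_order /= lexx vv.
Qed.

(** An infinite convex part meets two blocks, hence contains a full subtree. *)
Lemma infinite_convex_graft I : convex_subset r I -> infinite_set I ->
  exists q, forall x, dom r (graft q x) -> I (graft q x).
Proof.
move=> [Id Ic] Iinf.
have tree x y : I x -> I y -> (word x < word y)%O -> x.1 <> y.1 ->
    exists q, forall z, dom r (graft q z) -> I (graft q z).
  move=> Ix Iy /word_lt[[-> //]|[q qP]] _; exists q => z rz.
  have /andP[/ltW xz /ltW zy] := qP z.
  by apply: (Ic x _ y) => //; rewrite block_orderE //; exact: Id.
have [a Ia] := infinite_setN0 Iinf.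
have [[b Ib ab]|same] := pselect (exists2 b, I b & a.1 <> b.1).
  have : word a != word b by apply/eqP => /word_inj abE; rewrite abE in ab.
  by rewrite neq_lt => /orP[lt|lt];
    [apply: (tree a b)|apply: (tree b a)] => //; auto.
case: Iinf; (* Otherwise the whole part lies in the finite block of [a]. *)
apply: (@sub_finite_set _ _
  ((fun j => (a.1, j)) @` `I_(c (size a.1.1) a.1.2).+1)).
  move=> [u j] Ib; have uE : a.1 = u.
    by apply: contrapT => ne; apply: same; exists (u, j).
  have := Id _ Ib; rewrite dom_block_order /= -uE => jc.
  by exists j.
exact/finite_image/finite_II.
Qed.

End BlockOrder.

(** * Codes on the natural numbers *)

Lemma infinite_range (T : Type) (f : nat -> T) (A : set T) :
  injective f -> (forall n, A (f n)) -> infinite_set A.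
Proof.
move=> finj fA; apply: (@sub_infinite_set _ (range f)).
  by move=> _ [n _ <-].
apply/infiniteP; have /card_esym : (range f #= [set: nat])%card.
  by apply: inj_card_eq => x y _ _; exact: finj.
by rewrite card_eq_le => /andP[].
Qed.

Lemma infinite_unbounded (A : set nat) n : infinite_set A -> exists2 i, A i & n < i.
Proof.
move=> Ainf; apply: contrapT => none; apply: Ainf.
apply: (@sub_finite_set _ _ `I_n.+1); last exact: finite_II.
move=> i Ai /=; rewrite ltnS leqNgt; apply/negP => ni; apply: none.
by exists i.
Qed.

Lemma block_order_enum (c : nat -> nat -> nat) : exists g : nat -> point,
  [/\ injective g, forall n, dom (block_order c) (g n) &
      forall x, dom (block_order c) x -> exists n, g n = x].
Proof.
have : (dom (block_order c) #= [set: nat])%card.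
  apply: eq_card_nat; first exact: countableP.
  apply: (@infinite_range _ (fun n => ([:: n], 0, 0) : point)).
    by move=> m n [].
  by move=> n; rewrite dom_block_order.
case/card_set_bijP => f [fd finj fsurj].
have /choice[g gP] : forall n, exists x, dom (block_order c) x /\ f x = n.
  by move=> n; have [x dx fx] := fsurj n I; exists x.
exists g; split=> [m n gE|n|x dx].
- by have [_ <-] := gP m; have [_ <-] := gP n; rewrite gE.
- by have [] := gP n.
- exists (f x); have [dg fg] := gP (f x).
  by apply: finj => //; rewrite inE.
Qed.

(** An enumeration without repetition of the domain of [block_order c]. *)
Definition block_enum (c : nat -> nat -> nat) : nat -> point :=
  projT1 (cid (block_order_enum c)).

Lemma block_enumP c :
  [/\ injective (block_enum c), forall n, dom (block_order c) (block_enum c n) &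
      forall x, dom (block_order c) x -> exists n, block_enum c n = x].
Proof. exact: projT2 (cid (block_order_enum c)). Qed.

(** A copy of [block_order c] with domain the natural numbers. *)
Definition block_code (c : nat -> nat -> nat) : rel nat :=
  fun m n => block_order c (block_enum c m) (block_enum c n).

Section BlockCode.
Variable c : nat -> nat -> nat.

Lemma dom_block_code : dom (block_code c) = setT.
Proof.
by have [_ sub _] := block_enumP c; apply/seteqP; split=> // n _; exact: sub.
Qed.

Lemma block_code_LO : LO (block_code c).
Proof.
have [inj sub _] := block_enumP c.
have [_ asym trans tot] := block_order_linear c.
split; last exact: dom_block_code.
split; rewrite ?dom_block_code //.
- by move=> x y /asym; exact: inj.
- by move=> y x z; exact: trans.
- move=> x y _ _; apply: tot; exact: sub.
Qed.

Lemma block_code_order : convex_embeds (block_code c) (block_order c).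
Proof.
have [inj sub surj] := block_enumP c.
exists (block_enum c); split=> //; first exact/convex_dom/block_code_LO.1.
split=> [_ [n _ <-]|x y z xy _ _ _]; first exact: sub.
by have [n <-] := surj y (block_order_dom xy).2; exists n; rewrite ?dom_block_code.
Qed.

Lemma block_order_code : convex_embeds (block_order c) (block_code c).
Proof.
have [inj sub surj] := block_enumP c.
have /choice[f fP] : forall x, exists n,
    dom (block_order c) x -> block_enum c n = x.
  move=> x; have [dx|ndx] := pselect (dom (block_order c) x); last by exists 0.
  by have [n <-] := surj x dx; exists n.
exists f; split; first exact/convex_dom/block_order_linear.
- by move=> x y dx dy; rewrite /block_code !fP.
- split=> [n _|_ n _ _ _ _ _]; first by rewrite dom_block_code.
  by exists (block_enum c n); [exact: sub|apply: inj; rewrite fP; last exact: sub].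
Qed.

End BlockCode.

(** * Comparison of block orders *)

(** Some convex part of [block_order c] contains the first elements of infinitely
    many blocks of size [s + 1] at the root and is isomorphic to a convex part of
    [Y]. This property of [Y] is inherited upwards along piecewise convex
    embeddings with finitely many pieces. *)
Definition has_blocks (c : nat -> nat -> nat) (s : nat) (T : Type) (Y : rel T) :=
  exists I h, convex_emb (block_order c) Y I h /\
    infinite_set [set i | c 0 i = s /\ I ([::], i, 0)].

Section HasBlocks.
Variables (c : nat -> nat -> nat) (s : nat).

Lemma has_blocks_embeds T (Y : rel T) : infinite_set [set i | c 0 i = s] ->
  convex_embeds (block_order c) Y -> has_blocks c s Y.
Proof.
move=> inf [h hE]; exists (dom (block_order c)), h; split=> //.
by apply: sub_infinite_set inf => i /= ?; rewrite dom_block_order.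
Qed.

Lemma has_blocks_pconvex (C : set (rel nat)) (Y Z : rel nat) : C `<=` Fin ->
  linear_order Y -> pconvex C Y Z -> has_blocks c s Y -> has_blocks c s Z.
Proof.
move=> CFin Ylin YZ [I [h [hE inf]]].
have [D [P [f [Dfin PU fE]]]] := pconvex_pieces CFin Ylin YZ.
pose A k := [set i | c 0 i = s /\ (I `&` h @^-1` P k) ([::], i, 0)].
have [[k Dk Ainf]|fin] := pselect (exists2 k, D k & infinite_set (A k)).
  exists (I `&` h @^-1` P k), (f \o h); split=> //.
  exact: convex_emb_comp (fE k Dk).
case: inf; apply: (@sub_finite_set _ _ (\bigcup_(k in D) A k)).
  move=> i [ci Ii]; have := convex_emb_dom hE Ii.
  by rewrite -PU => -[k Dk Pk]; exists k.
by apply: bigcup_finite => // k Dk; apply: contrapT => ?; apply: fin; exists k.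
Qed.

(** A convex part containing points of three blocks at the root contains the
    middle one together with points on both sides. A convex embedding then maps
    this maximal run of consecutive elements onto such a run, that is, a block
    onto a block of the same size. *)
Lemma has_blocks_order c' : has_blocks c s (block_order c') ->
  exists l i, c' l i = s.
Proof.
move=> [I [h [hE inf]]].
have rlin := block_order_linear c; have r'lin := block_order_linear c'.
have [i1 [_ Ii1] _] := infinite_unbounded 0 inf.
have [i2 [ci2 Ii2] i12] := infinite_unbounded i1 inf.
have [i3 [_ Ii3] i23] := infinite_unbounded i2 inf.
have [[Id Ic] hr [h'd h'c]] := hE.
have rw k k' i i' : I ([::], i, k) -> I ([::], i', k') -> i < i' ->
    [/\ block_order c ([::], i, k) ([::], i', k') &
        ~ block_order c ([::], i', k') ([::], i, k)].
  move=> /Id Ik /Id Ik' ii'; rewrite !block_orderE // !word_nil !lexi_consE.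
  by split; [|apply/negP]; lia.
have Iblock k : k <= s -> I ([::], i2, k).
  move=> ks; apply: (Ic _ _ _ _ _ Ii2 Ii3).
    rewrite block_orderE ?dom_block_order //= ?ci2 //.
    by rewrite !word_nil lexi_consE eqxx lexi_consE lexi0s; lia.
  rewrite block_orderE ?dom_block_order //= ?ci2 //.
  by rewrite !word_nil lexi_consE; lia.
(* [i1] and [i3] provide points of [I] on both sides of block [i2], so that by
   convexity an immediate predecessor of the image of the first element of that
   block, or an immediate successor of the image of its last, is itself an image. *)
have [[[p i] j0] h0] : exists x, h ([::], i2, 0) = x by eexists.
have j00 : j0 = 0.
  case: j0 h0 => // j h0.
  have dh : dom (block_order c') (p, i, j.+1).
    by rewrite -h0; exact: convex_emb_dom hE Ii2.
  have cov := block_order_covers dh.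
  have [wh nwh nb] := cov.
  have [h12 nh21] := rw _ _ _ _ Ii1 Ii2 i12.
  rewrite !hr // h0 in h12 nh21.
  have dw := (block_order_dom wh).1.
  have h1w : block_order c' (h ([::], i1, 0)) (p, i, j).
    have [_ _ _ tot] := r'lin.
    case/orP: (tot _ _ (block_order_dom h12).1 dw) => // wh1.
    have [->//|h1E] := nb _ wh1 h12.
    by case: nh21; rewrite h1E; exact: dh.
  have [z Iz zE] : (h @` I) (p, i, j).
    by apply: (h'c _ _ _ h1w wh); [exists ([::], i1, 0)|exists ([::], i2, 0)].
  have : covers (block_order c) z ([::], i2, 0).
    by apply/(covers_convex_emb rlin hE Iz Ii2); rewrite zE h0.
  by case/covers_block_order => p' [i' [j' [_ []]]].
have hblock k : k <= s -> h ([::], i2, k) = (p, i, k).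
  elim: k => [|k IH] ks; first by rewrite h0 j00.
  have : covers (block_order c) ([::], i2, k) ([::], i2, k.+1).
    by apply: block_order_covers; exact: Id (Iblock _ ks).
  move/(covers_convex_emb rlin hE (Iblock _ (ltnW ks)) (Iblock _ ks)).
  rewrite IH; last exact: ltnW.
  by case/covers_block_order => p' [i' [j' [[<- <- <-] ->]]].
exists (size p), i; apply/eqP; rewrite eqn_leq; apply/andP; split; last first.
  have := convex_emb_dom hE (Iblock s (leqnn s)).
  by rewrite hblock // dom_block_order.
rewrite leqNgt; apply/negP => sc'.
have cov : covers (block_order c') (p, i, s) (p, i, s.+1).
  by apply: block_order_covers; rewrite dom_block_order.
have [hw nhw nb] := cov.
have [h23 nh32] := rw _ _ _ _ (Iblock s (leqnn s)) Ii3 i23.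
rewrite !hr // ?hblock // in h23 nh32; try exact: Iblock.
have wh3 : block_order c' (p, i, s.+1) (h ([::], i3, 0)).
  have [_ _ _ tot] := r'lin.
  case/orP: (tot _ _ (block_order_dom hw).2 (block_order_dom h23).2) => // h3w.
  have [h3E|->] := nb _ h23 h3w; last exact: (block_order_dom hw).2.
  by case: nh32; rewrite h3E; exact: (block_order_dom hw).1.
have [z Iz zE] : (h @` I) (p, i, s.+1).
  apply: (h'c _ _ _ hw wh3); last by exists ([::], i3, 0).
  by exists ([::], i2, s); [exact: Iblock|exact: hblock].
have : covers (block_order c) ([::], i2, s) z.
  by apply/(covers_convex_emb rlin hE (Iblock s (leqnn s)) Iz); rewrite zE hblock.
case/covers_block_order => p' [i' [j' [[<- <- <-] zE']]].
by have := Id _ Iz; rewrite zE' dom_block_order /= ci2 ltnn.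
Qed.

(** Block sizes at the root that occur infinitely often survive two
    successive piecewise convex embeddings. *)
Lemma pconvex_block_size (C : set (rel nat)) (Y Z : rel nat) c' : C `<=` Fin ->
  infinite_set [set i | c 0 i = s] -> LO Y -> LO Z ->
  convex_embeds (block_order c) Y -> pconvex C Y Z ->
  pconvex C Z (block_code c') -> exists l i, c' l i = s.
Proof.
move=> CFin inf [Ylin _] [Zlin _] cY YZ Zc'; apply: has_blocks_order.
have [I [h [hE hinf]]] : has_blocks c s (block_code c').
  apply: (has_blocks_pconvex CFin Zlin Zc').
  by apply: (has_blocks_pconvex CFin Ylin YZ); exact: has_blocks_embeds.
have [g gE] := block_code_order c'.
exists (I `&` h @^-1` dom (block_code c')), (g \o h).
split; first exact: convex_emb_comp gE.
by apply: sub_infinite_set hinf => n [? ?]; rewrite dom_block_code.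
Qed.

End HasBlocks.

(** An infinite order below a block order has an infinite piece, whose image
    contains a full subtree. *)
Lemma pconvex_block_code_subtree (C : set (rel nat)) (Y : rel nat) c :
  C `<=` Fin -> LO Y -> pconvex C Y (block_code c) ->
  exists l, convex_embeds (block_order (shift l c)) Y.
Proof.
move=> CFin [Ylin Yd] Yc.
have rlin := block_order_linear c.
have [D [P [f [Dfin PU fE]]]] := pconvex_pieces CFin Ylin Yc.
have [k Dk Pinf] : exists2 k, D k & infinite_set (P k).
  apply: contrapT => fin; apply: infinite_nat; rewrite -Yd -PU.
  by apply: bigcup_finite => // k Dk; apply: contrapT => ?; apply: fin; exists k.
have [g gE] := block_code_order c.
have := convex_emb_comp (fE k Dk) gE.
rewrite dom_block_code preimage_setT setIT => hE.
have [_ _ hc] := hE.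
have hinf : infinite_set ((g \o f) @` P k).
  move: Pinf; apply: contra_not; apply: card_le_finite.
  have /card_esym : (((g \o f) @` P k) #= P k)%card.
    apply: inj_card_eq => x y /set_mem Px /set_mem Py.
    exact: (convex_emb_inj Ylin hE).
  by rewrite card_eq_le => /andP[].
have [q qP] := infinite_convex_graft hc hinf.
have [e [eE _]] := convex_emb_inv 0 Ylin hE.
exists (size q), (e \o graft q).
have qE := graft_convex_emb c q.
rewrite -[dom _](_ : dom (block_order (shift (size q) c)) `&`
   graft q @^-1` ((g \o f) @` P k) = _); first exact: convex_emb_comp eE.
apply/seteqP; split=> [x []//|x dx]; split=> //.
by apply: qP; exact: convex_emb_dom qE dx.
Qed.

(** * Minimal orders and strictly decreasing sequences *)

(** Takes every value infinitely often. *)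
Definition repeating (i : nat) : nat :=
  (odflt (0, 0) (@unpickle (nat * nat)%type i)).1.

(** At every node the block sizes [2 k + f k + 1] occur infinitely often; the
    sets of block sizes for distinct [f] are incomparable under inclusion. *)
Definition coded_sizes (f : nat -> bool) : nat -> nat -> nat :=
  fun _ i => (repeating i).*2 + f (repeating i).

(** All blocks at depth [l] have [n + l + 1] elements, so a block size is lost
    in passing to the subtree at a successor node. *)
Definition growing_sizes (n : nat) : nat -> nat -> nat := fun l _ => n + l.

Lemma coded_sizes_infinite f k :
  infinite_set [set i | coded_sizes f 0 i = k.*2 + f k].
Proof.
apply: (@infinite_range _ (fun m => pickle (k, m))).
  by move=> m n /(pcan_inj pickleK)[].
by move=> m; rewrite /= /coded_sizes /repeating pickleK.
Qed.

Lemma coded_sizes_inj (f g : nat -> bool) :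
  (forall k, exists l i, coded_sizes g l i = k.*2 + f k) -> f = g.
Proof.
move=> fg; apply/funext => k; have [l [i]] := fg k.
rewrite /coded_sizes; move: (repeating i) => m.
have [->|mk mE] := eqVneq m k; first by case: (f k); case: (g k); lia.
by move/eqP: mk; case: (f k) mE; case: (g m) => /=; lia.
Qed.

Section Minimal.
Variable L : set (rel nat).
Hypotheses (L_Fin : L `<=` Fin) (L_neq0 : L !=set0) (L_down : downward_closed L).

Lemma LO_convex_pconvex Y Z : LO Y -> convex_embeds Y Z -> pconvex L Y Z.
Proof. by move=> [_ Yd]; apply: convex_pconvex => //; rewrite Yd; exists 0. Qed.

Lemma pconvex_refl Y : LO Y -> pconvex L Y Y.
Proof.
move=> YLO; apply: LO_convex_pconvex => //; exists id.
have Yc := convex_dom YLO.1.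
by split=> //; rewrite image_id.
Qed.

Lemma coded_below f Y : LO Y -> pconvex L Y (block_code (coded_sizes f)) ->
  convex_embeds (block_order (coded_sizes f)) Y.
Proof. by move=> YLO /(pconvex_block_code_subtree L_Fin YLO)[l]. Qed.

Lemma coded_minimal f : qo_minimal LO (pconvex L) (block_code (coded_sizes f)).
Proof.
split=> [|[Y [YLO Yf []]]]; first exact: block_code_LO.
apply: LO_convex_pconvex; first exact: block_code_LO.
exact: convex_embeds_comp (block_code_order _) (coded_below YLO Yf).
Qed.

(** The orders coded by distinct [f] have no common lower bound. *)
Lemma coded_common_below f g Y : LO Y ->
  pconvex L Y (block_code (coded_sizes f)) ->
  pconvex L Y (block_code (coded_sizes g)) -> f = g.
Proof.
move=> YLO Yf Yg; apply: coded_sizes_inj => k.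
apply: (pconvex_block_size L_Fin (@coded_sizes_infinite f k) YLO YLO _ _ Yg).
  exact: coded_below.
exact: pconvex_refl.
Qed.

(** From [Y] pass to a subtree that it contains, then to a subtree one level
    deeper, and then to a basis element below the latter. Both
    [pconvex L Z Y] and its failure in the other direction come from convex
    embeddings, without transitivity of [pconvex L]. *)
Lemma growing_step n Y (B : set (rel nat)) : qo_basis LO (pconvex L) B -> B Y ->
  pconvex L Y (block_code (growing_sizes n)) ->
  exists m Z, [/\ B Z, pconvex L Z (block_code (growing_sizes m)),
                  pconvex L Z Y & ~ pconvex L Y Z].
Proof.
move=> [BLO Bbelow] BY Yn.
have [l] := pconvex_block_code_subtree L_Fin (BLO _ BY) Yn.
rewrite (_ : shift l _ = growing_sizes (n + l)); last first.
  by apply/funext => k; apply/funext => i; rewrite /shift /growing_sizes addnA.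
move: (n + l) => m mY.
have [Z BZ Zm] := Bbelow _ (block_code_LO (growing_sizes m.+1)).
exists m.+1, Z; split=> //.
  apply: pconvex_comp_convex Zm _; apply: convex_embeds_comp mY.
  apply: convex_embeds_comp (block_code_order _) _.
  exists (graft [:: 0]).
  rewrite (_ : growing_sizes m.+1 = shift (size [:: 0]) (growing_sizes m)).
    exact: graft_convex_emb.
  by apply/funext => k; apply/funext => i; rewrite /shift /growing_sizes addSnnS.
move=> YZ; have inf : infinite_set [set i | growing_sizes m 0 i = m].
  by apply: (@infinite_range _ id) => // i /=; rewrite /growing_sizes addn0.
have [k [i]] := pconvex_block_size L_Fin inf (BLO _ BY) (BLO _ BZ) mY YZ Zm.
by rewrite /growing_sizes; lia.
Qed.

Lemma basis_ill_founded (B : set (rel nat)) :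
  qo_basis LO (pconvex L) B -> qo_ill_founded (pconvex L) B.
Proof.
move=> Bbasis; have [_ Bbelow] := Bbasis.
pose good (s : nat * rel nat) :=
  B s.2 /\ pconvex L s.2 (block_code (growing_sizes s.1)).
have /choice[next nextP] : forall s, exists s', good s ->
    [/\ good s', pconvex L s'.2 s.2 & ~ pconvex L s.2 s'.2].
  move=> [n Y]; have [[BY Yn]|] := pselect (good (n, Y)); last by exists (n, Y).
  by have [m [Z [BZ Zm ZY YZ]]] := growing_step Bbasis BY Yn; exists (m, Z).
have [Y BY Y0] := Bbelow _ (block_code_LO (growing_sizes 0)).
have goodn n : good (iter n next (0, Y)).
  by elim: n => [//|n /nextP[]].
exists (fun n => (iter n next (0, Y)).2); split=> n; first by have [] := goodn n.
by have [] := nextP _ (goodn n).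
Qed.

(** Choosing a basis element below each coded minimal order is injective. *)
Lemma basis_continuum (B : set (rel nat)) :
  qo_basis LO (pconvex L) B -> continuum B.
Proof.
move=> [BLO Bbelow]; rewrite /continuum card_eq_le; apply/andP; split.
  apply: (@card_le_trans _ _ _ [set: rel nat]); first exact: subset_card_le.
  apply/pcard_injP; exists (fun (r : rel nat) n =>
    let: (a, b) := odflt (0, 0) (@unpickle (nat * nat)%type n) in r a b) => //.
  move=> r s _ _ rs; apply/funext => a; apply/funext => b.
  by have := congr1 (fun u => u (pickle (a, b))) rs; rewrite /= pickleK.
have /choice[b bP] : forall f, exists Y,
    B Y /\ pconvex L Y (block_code (coded_sizes f)).
  by move=> f; have [Y] := Bbelow _ (block_code_LO (coded_sizes f)); exists Y.
apply: (@card_le_trans _ _ _ (range b)); last first.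
  by apply: subset_card_le => Y [f _ <-]; have [] := bP f.
have /card_esym : (range b #= [set: nat -> bool])%card.
  apply: inj_card_eq => f g _ _ fg.
  have [BY Yf] := bP f; have [_ Yg] := bP g; rewrite -fg in Yg.
  exact: coded_common_below (BLO _ BY) Yf Yg.
by rewrite card_eq_le => /andP[].
Qed.

End Minimal.

Theorem theorem5p6 (L : set (rel nat)) (L_Fin : L `<=` Fin) (L_neq0 : L !=set0)
    (L_down : downward_closed L) (L_ccs : ccs L) :
  (exists A : set (rel nat),
     [/\ continuum A,
         forall x, A x -> qo_minimal LO (pconvex L) x &
         qo_antichain LO (pconvex L) A]) /\
  (forall B : set (rel nat), qo_basis LO (pconvex L) B ->
     [/\ continuum B,
         qo_ill_founded (pconvex L) B &
         ~ qo_antichain LO (pconvex L) B]).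
Proof.
split.
  pose D f := block_code (coded_sizes f).
  have DLO f : LO (D f) by exact: block_code_LO.
  have Drefl f : pconvex L (D f) (D f) by exact: pconvex_refl.
  exists (range D); split.
  - apply: inj_card_eq => f g _ _ fg.
    apply: (coded_common_below L_Fin L_neq0 L_down (DLO f)); first exact: Drefl.
    by rewrite -/(D g) -fg; exact: Drefl.
  - by move=> _ [f _ <-]; exact: coded_minimal.
  - split=> [_ [f _ <-] //|_ _ [f _ <-] [g _ <-] fg].
    split=> le; apply: fg; congr D.
      exact: (coded_common_below L_Fin L_neq0 L_down (DLO f)).
    by apply: esym; exact: (coded_common_below L_Fin L_neq0 L_down (DLO g)).
move=> B Bbasis; have Bill := basis_ill_founded L_Fin Bbasis.
split=> //; first exact: (basis_continuum L_Fin L_neq0 L_down).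
move=> [_ anti]; have [u [uB udec]] := Bill; have [u10 u01] := udec 0.
have u1E : u 1 <> u 0 by move=> uE; apply: u01; rewrite uE in u10 *.
by have [] := anti _ _ (uB 1) (uB 0) u1E.
Qed.
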